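(* Let $d,T,N,k\ge 1$ be integers with $k\le N$, let $\bar\mu\in\mathbb{R}^d$, and let $\sigma,\bar\sigma>0$. Let $\mu_1,\dots,\mu_T$ be i.i.d. from $\mathcal N(\bar\mu,\bar\sigma^2\mathbb I_d)$ and, given these, for each $i$ let $X_i=\{X_{i,1},\dots,X_{i,N}\}$ be $N$ i.i.d. samples from $\mathcal N(\mu_i,\sigma^2\mathbb I_d)$ (independently across $i$). Let $\hat\mu=\frac1T\sum_{i=1}^T\frac1N\sum_{j=1}^N X_{i,j}$. Let $\tau\in\{1,\dots,T\}$ be the index of the target task, and let the weak adversary receive a challenge set $B$ of $k$ samples as described in the context (in the IN case, $B$ consists of $k$ fresh i.i.d. samples from $\mathcal N(\mu_\tau,\sigma^2\mathbb I_d)$). Let $\mu_B=\frac1k\sum_{x\in B}x$ and $z=\langle \hat\mu-\bar\mu,\ \mu_B-\bar\mu\rangle$, and write $z_{OUT}$, $z_{IN}$ for $z$ in the OUT and IN cases respectively. Then, with expectation over the sampling of the tasks and the data, $$\mathbb E[z_{OUT}]=0\qquad\text{and}\qquad \mathbb E[z_{IN}]=\frac dT\,\bar\sigma^2.$$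
   Context: $\mathbb I_d$ is the $d\times d$ identity matrix and $\langle\cdot,\cdot\rangle$ is the Euclidean inner product on $\mathbb R^d$. The challenge set $B$, $|B|=k$, is generated in one of two ways. OUT case: the challenge task was not used to compute $\hat\mu$: a fresh task mean $\mu_{OUT}\sim\mathcal N(\bar\mu,\bar\sigma^2\mathbb I_d)$ is drawn independently of all $\mu_i$ and $X_i$, and $B$ consists of $k$ i.i.d. samples from $\mathcal N(\mu_{OUT},\sigma^2\mathbb I_d)$, independent of $\hat\mu$. IN case for the weak adversary: conditionally on $\mu_1,\dots,\mu_T$, $B$ consists of $k$ i.i.d. samples from $\mathcal N(\mu_\tau,\sigma^2\mathbb I_d)$, independent of all the data $X_1,\dots,X_T$ used to compute $\hat\mu$. *)

(* Defs.v *)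
From HB Require Import structures.
From mathcomp Require Import all_boot all_order all_algebra.
From mathcomp Require Import all_classical all_reals all_analysis.

Set Implicit Arguments.
Unset Strict Implicit.
Unset Printing Implicit Defensive.

Import Order.TTheory GRing.Theory Num.Theory.
Import numFieldNormedType.Exports.

Local Open Scope classical_set_scope.
Local Open Scope ring_scope.

(* sigma(f_j, j : J): the sigma-algebra on [aT] generated by the family [f]. *)
Definition sigma_generated (aT J : Type) d (rT : measurableType d)
    (f : J -> aT -> rT) : set (set aT) :=
  <<s \bigcup_j preimage_set_system setT (f j) measurable >>.

(* The Borel sigma-algebra of R^d, i.e. the one generated by the coordinates. *)
Section measurable_row.
Context (R : realType) (n : nat).

Definition measurable_row : set (set 'rV[R]_n) :=
  sigma_generated (fun (c : 'I_n) (v : 'rV[R]_n) => v ord0 c).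

Let row0 : measurable_row set0.
Proof. exact: sigma_algebra0. Qed.

Let rowC A : measurable_row A -> measurable_row (~` A).
Proof. exact: sigma_algebraC. Qed.

Let row_bigcup (F : (set 'rV[R]_n)^nat) :
  (forall i, measurable_row (F i)) -> measurable_row (\bigcup_i (F i)).
Proof. exact: sigma_algebra_bigcup. Qed.

HB.instance Definition _ := @isMeasurable.Build default_measure_display
  'rV[R]_n measurable_row row0 rowC row_bigcup.

Lemma measurable_coord (c : 'I_n) :
  measurable_fun [set: 'rV[R]_n] (fun v => v ord0 c).
Proof.
move=> _ A mA; apply: sub_sigma_algebra; exists c => //; exists A => //.
Qed.

Lemma measurable_fun_row d (aT : measurableType d) (f : aT -> 'rV[R]_n) :
  (forall c, measurable_fun setT (fun x => f x ord0 c)) ->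
  measurable_fun setT f.
Proof.
move=> mf; apply: (@measurability _ _ _ _ _ _
  (\bigcup_c preimage_set_system setT
    (fun v : 'rV[R]_n => v ord0 c) measurable)) => //.
move=> _ [_ [c _ [A mA <-]] <-].
rewrite (_ : _ `&` _ = setT `&` (fun x => f x ord0 c) @^-1` A).
  exact: mf.
by rewrite !setTI.
Qed.

End measurable_row.

Section isotropic_gaussian.
Context {R : realType}.

Definition row_cons n (xv : measurableTypeR R * 'rV[R]_n) : 'rV[R]_n.+1 :=
  \row_c (if unlift ord0 c is Some c' then xv.2 ord0 c' else xv.1).

Definition row_behead n (v : 'rV[R]_n.+1) : 'rV[R]_n :=
  \row_c v ord0 (lift ord0 c).

Lemma measurable_row_cons n : measurable_fun setT (@row_cons n).
Proof.
apply: measurable_fun_row => c; under eq_fun do rewrite mxE.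
case: unliftP => [c' _|_]; last exact: measurable_fst.
apply: (@measurableT_comp _ _ _ _ _ _ (fun v : 'rV[R]_n => v ord0 c')).
  exact: measurable_coord.
exact: measurable_snd.
Qed.

HB.instance Definition _ n :=
  isMeasurableFun.Build _ _ _ _ (@row_cons n) (@measurable_row_cons n).

(* N(m, s^2 I_n), as the product over c < n of the laws N(m_c, s^2); [s] is
   the standard deviation, as in [normal_prob]. *)
Fixpoint gaussian n : 'rV[R]_n -> R -> probability 'rV[R]_n R :=
  match n with
  | 0 => fun m _ => dirac m
  | n'.+1 => fun m s =>
      distribution (normal_prob (m ord0 ord0) s \x gaussian (row_behead m) s)%E
        (@row_cons n')
  end.

Lemma gaussian_box n (m : 'rV[R]_n) s (A : 'I_n -> set R) :
  (forall c, measurable (A c)) ->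
  gaussian m s [set v | forall c, A c (v ord0 c)] =
  (\prod_(c < n) normal_prob (m ord0 c) s (A c))%E.
Proof.
elim: n m A => [|n IH] m A mA /=.
  rewrite big_ord0 diracE mem_set//.
  by case.
rewrite /distribution /pushforward.
rewrite (_ : _ @^-1` _ = A ord0 `*`
    [set v : 'rV[R]_n | forall c, A (lift ord0 c) (v ord0 c)]).
  rewrite product_measure1E//; last first.
    rewrite (_ : [set _ | _] = \bigcap_(c in [set: 'I_n])
      (fun v : 'rV[R]_n => v ord0 c) @^-1` A (lift ord0 c)).
      apply: fin_bigcap_measurable => // c _.
      by rewrite -[X in measurable X]setTI; exact: measurable_coord.
    by apply/seteqP; split=> v /= h c; [move=> _|]; exact: h.
    exact: mA.
  rewrite big_ord_recl; congr (_ * _)%E.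
  transitivity (\prod_(c < n) normal_prob (row_behead m ord0 c) s
      (A (lift ord0 c)))%E.
    exact: (IH (row_behead m) (fun c => A (lift ord0 c))).
  by apply: eq_bigr => c _; rewrite mxE.
apply/seteqP; split=> -[x v] /=.
  move=> h; split; first by have := h ord0; rewrite mxE unlift_none.
  by move=> c; have := h (lift ord0 c); rewrite mxE liftK.
move=> [h0 h] c; rewrite mxE; case: unliftP => [c' ->|->] //=.
Qed.

End isotropic_gaussian.

Section independence.
Context {R : realType} {d} {Omega : measurableType d} (P : probability Omega R).
Local Open Scope ereal_scope.

Definition independent_classes (G H : set (set Omega)) : Prop :=
  forall A B, G A -> H B -> P (A `&` B) = P A * P B.

Definition mutually_independent (J : finType) d' (E : measurableType d')
    (Y : J -> Omega -> E) : Prop :=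
  forall A : J -> set E, (forall j, measurable (A j)) ->
    P (\bigcap_j Y j @^-1` A j) = \prod_j P (Y j @^-1` A j).

Definition has_law d' (E : measurableType d') (Y : Omega -> E)
    (nu : probability E R) : Prop :=
  forall A, measurable A -> P (Y @^-1` A) = nu A.

Definition iid (J : finType) d' (E : measurableType d')
    (Y : J -> Omega -> E) (nu : probability E R) : Prop :=
  mutually_independent Y /\ forall j, has_law (Y j) nu.

(* Conditionally on the sigma-algebra [G], the [Y j] are independent with
   respective (random, [G]-measurable) laws [K j], that is,
   P(Y_j \in A_j for all j | G) = \prod_j K_j(A_j) almost surely. *)
Definition conditionally_independent (G : set (set Omega)) (J : finType)
    d' (E : measurableType d') (Y : J -> Omega -> E)
    (K : J -> Omega -> probability E R) : Prop :=
  forall C (A : J -> set E), G C -> (forall j, measurable (A j)) ->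
    P (C `&` \bigcap_j Y j @^-1` A j) = \int[P]_(w in C) \prod_j K j w (A j).

End independence.

Definition sum_family (J1 J2 E : Type) (f : J1 -> E) (g : J2 -> E)
    (j : J1 + J2) : E :=
  match j with inl j1 => f j1 | inr j2 => g j2 end.

Definition inner (R : realType) n (u v : 'rV[R]_n) : R :=
  \sum_(c < n) u ord0 c * v ord0 c.

Section model.
Context {R : realType} {disp} {Omega : measurableType disp}.
Context (P : probability Omega R) {d T N k : nat}.
Implicit Types (mubar : 'rV[R]_d) (sigma sigmabar : R).
Implicit Types (mu : 'I_T -> Omega -> 'rV[R]_d).
Implicit Types (X : 'I_T -> 'I_N -> Omega -> 'rV[R]_d).
Implicit Types (B : 'I_k -> Omega -> 'rV[R]_d).

Definition data X (ij : 'I_T * 'I_N) : Omega -> 'rV[R]_d := X ij.1 ij.2.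

Definition tasks_and_data mubar sigma sigmabar mu X : Prop :=
  iid P mu (gaussian mubar sigmabar) /\
  conditionally_independent P (sigma_generated mu) (data X)
    (fun ij w => gaussian (mu ij.1 w) sigma).

Definition muhat X (w : Omega) : 'rV[R]_d :=
  T%:R^-1 *: \sum_(i < T) (N%:R^-1 *: \sum_(j < N) X i j w).

Definition challenge_mean B (w : Omega) : 'rV[R]_d :=
  k%:R^-1 *: \sum_(l < k) B l w.

Definition statistic mubar X B (w : Omega) : R :=
  inner (muhat X w - mubar) (challenge_mean B w - mubar).

Definition out_challenge mubar sigma sigmabar mu X
    (muout : Omega -> 'rV[R]_d) B : Prop :=
  [/\ has_law P muout (gaussian mubar sigmabar),
      independent_classes P (sigma_generated (fun _ : unit => muout))
        (sigma_generated (sum_family mu (data X))),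
      conditionally_independent P (sigma_generated (fun _ : unit => muout)) B
        (fun _ w => gaussian (muout w) sigma) &
      independent_classes P (sigma_generated B)
        (sigma_generated (fun _ : unit => muhat X))].

(* The fresh samples are drawn around the mean of the task [tau]; given the
   task means, they are independent of each other and of all the data. *)
Definition weak_in_challenge sigma mu X (tau : 'I_T) B : Prop :=
  conditionally_independent P (sigma_generated mu) (sum_family (data X) B)
    (sum_family (fun ij w => gaussian (mu ij.1 w) sigma)
                (fun _ w => gaussian (mu tau w) sigma)).

End model.

(* Main.v *)
(* Bilinearity reduces E[z] to the coordinatewise means
   E[(hat mu_c - bar mu_c) (B_lc - bar mu_c)].  In the OUT case B is independent
   of hat mu and both factors are centered.  In the IN case hat mu is expanded as
   well; given the task means, the pair (X_ijc, B_lc) has the law of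
   (mu_ic - x, mu_tau,c - y), with x and y independent centered Gaussian noises,
   so that the noise integrates out and leaves
   E[(mu_ic - bar mu_c) (mu_tau,c - bar mu_c)], which is bar sigma^2 when
   i = tau and 0 otherwise. *)
From HB Require Import structures.
Require Import Defs.
From mathcomp Require Import all_boot all_order all_algebra.
From mathcomp Require Import all_classical all_reals all_analysis.
From mathcomp Require Import measurable_realfun ring lra.

Set Implicit Arguments.
Unset Strict Implicit.
Unset Printing Implicit Defensive.

Import Order.TTheory GRing.Theory Num.Theory.
Import numFieldNormedType.Exports.

Local Open Scope classical_set_scope.
Local Open Scope ring_scope.

(** Integrability is carried along with the value, since linearity and Fubini require it. The
    measure is arbitrary so that task spaces, noise laws and their products are treated alike. *)
Definition has_mean {R : realType} d (T : measurableType d)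
    (m : {measure set T -> \bar R}) (f : T -> R) (e : R) : Prop :=
  m.-integrable [set: T] (EFin \o f) /\ (\int[m]_x (f x)%:E = e%:E)%E.

(** * Means: linearity, products, transfer along equal laws *)

Section has_mean_theory.
Context {R : realType}.

Lemma has_mean_measurable d (T : measurableType d)
    (m : {measure set T -> \bar R}) (f : T -> R) e :
  has_mean m f e -> measurable_fun setT f.
Proof. by case=> /measurable_int /measurable_EFinP. Qed.

Lemma has_mean_cst d (T : measurableType d) (m : probability T R) (r : R) :
  has_mean m (cst r) r.
Proof.
split; first exact: finite_measure_integrable_cst.
by rewrite /= integral_cst//= probability_setT mule1.
Qed.

Lemma has_meanD d (T : measurableType d) (m : {measure set T -> \bar R})
    (f g : T -> R) a b :
  has_mean m f a -> has_mean m g b -> has_mean m (fun x => f x + g x) (a + b).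
Proof.
move=> [fi fE] [gi gE]; split; first exact: integrableD fi gi.
by rewrite EFinD -fE -gE -integralD_EFin.
Qed.

Lemma has_meanZ d (T : measurableType d) (m : {measure set T -> \bar R})
    (f : T -> R) (r a : R) :
  has_mean m f a -> has_mean m (fun x => r * f x) (r * a).
Proof.
move=> [fi fE]; split; first exact: integrableZl fi.
by rewrite EFinM -fE -integralZl.
Qed.

Lemma has_meanN d (T : measurableType d) (m : {measure set T -> \bar R})
    (f : T -> R) (a : R) :
  has_mean m f a -> has_mean m (fun x => - f x) (- a).
Proof.
move=> /(has_meanZ (-1)); rewrite mulN1r.
by under [X in has_mean _ X]funext do rewrite mulN1r.
Qed.

Lemma has_mean_sum d (T : measurableType d) (m : {measure set T -> \bar R})
    (I : finType) (f : I -> T -> R) (a : I -> R) :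
  (forall i, has_mean m (f i) (a i)) ->
  has_mean m (fun x => \sum_i f i x) (\sum_i a i).
Proof.
move=> fa; split.
  under [X in _.-integrable _ X]funext do rewrite /= -sumEFin.
  by apply: integrable_sum => // i _; have [] := fa i.
under eq_integral do rewrite -sumEFin.
rewrite integral_sum//; last by move=> i; have [] := fa i.
by rewrite -sumEFin; apply: eq_bigr => i _; have [] := fa i.
Qed.

(** Fubini. By Tonelli the iterated integral of [|f| |g|] factors into two finite integrals, which
    gives integrability of the product. *)
Lemma has_mean_prod d1 d2 (T1 : measurableType d1) (T2 : measurableType d2)
    (m1 : probability T1 R) (m2 : probability T2 R)
    (f : T1 -> R) (g : T2 -> R) a b :
  has_mean m1 f a -> has_mean m2 g b ->
  has_mean (m1 \x m2)%E (fun z => f z.1 * g z.2) (a * b).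
Proof.
move=> fa gb; have [fi fE] := fa; have [gi gE] := gb.
have mf := has_mean_measurable fa; have mg := has_mean_measurable gb.
have mfg : measurable_fun setT (EFin \o (fun z : T1 * T2 => f z.1 * g z.2)).
  apply/measurable_EFinP; apply: measurable_funM; exact: measurableT_comp.
have intfg : (m1 \x m2)%E.-integrable setT
    (EFin \o (fun z : T1 * T2 => f z.1 * g z.2)).
  apply/integrable12ltyP => //=.
  under eq_integral.
    move=> x _; under eq_integral do rewrite normrM EFinM.
    rewrite ge0_integralZl//; first over.
    by apply/measurable_EFinP; exact: measurableT_comp.
  rewrite ge0_integralZr//; last 2 first.
    by apply/measurable_EFinP; exact: measurableT_comp.
    exact: integral_ge0.
  move/integrableP : fi => [_ flt]; move/integrableP : gi => [_ glt].
  by rewrite lte_mul_pinfty// ?integral_ge0// ge0_fin_numE// integral_ge0.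
split => //; rewrite -integral12_prod_meas1//= /fubini_F.
under eq_integral.
  move=> x _; under eq_integral do rewrite /= EFinM.
  rewrite integralZl// gE; over.
by rewrite integralZr// fE -EFinM.
Qed.

(** Rectangles are stable under intersection, contain the whole space and generate the product
    sigma-algebra, so two finite measures agreeing on them coincide. *)
Lemma eq_measure_rect d1 d2 (T1 : measurableType d1) (T2 : measurableType d2)
    (m1 m2 : probability (T1 * T2)%type R) :
  (forall A B, measurable A -> measurable B ->
    m1 (A `*` B) = m2 (A `*` B)) ->
  forall X, measurable X -> m1 X = m2 X.
Proof.
move=> m12 X mX.
pose C := [set A `*` B | A in measurable & B in measurable] : set (set (T1 * T2)).
apply: (measure_unique C (fun=> setT)) => //.
- by rewrite measurable_prod_measurableType.
- move=> _ _ [A1 mA1 [A2 mA2 <-]] [B1 mB1 [B2 mB2 <-]].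
  rewrite -setXI; exists (A1 `&` B1); first exact: measurableI.
  by exists (A2 `&` B2) => //; exact: measurableI.
- by move=> _; exists setT => //; exists setT => //; rewrite setXTT.
- by rewrite bigcup_const.
- by move=> _ [A mA [B mB <-]]; exact: m12.
- by move=> _; rewrite /= probability_setT ltry.
Qed.

(** Both integrals are integrals of [f] against the same image measure on [E]. *)
Lemma has_mean_transfer d1 d2 d (T1 : measurableType d1)
    (T2 : measurableType d2) (E : measurableType d)
    (m1 : probability T1 R) (m2 : probability T2 R)
    (phi : T1 -> E) (psi : T2 -> E) (f : E -> R) e :
  measurable_fun setT phi -> measurable_fun setT psi -> measurable_fun setT f ->
  (forall A, measurable A -> m1 (phi @^-1` A) = m2 (psi @^-1` A)) ->
  has_mean m2 (fun x => f (psi x)) e -> has_mean m1 (fun x => f (phi x)) e.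
Proof.
move=> mphi mpsi mf m12 [intf fE].
have mEf : measurable_fun setT (EFin \o f) by exact/measurable_EFinP.
(* The nonnegative change of variables, applied to [|f|], gives the integrability that the signed
   one requires. *)
have int1 : m1.-integrable setT (EFin \o (fun x => f (phi x))).
  apply/integrableP; split; first exact: measurableT_comp mEf mphi.
  have mabs : measurable_fun setT (abse \o (EFin \o f)) by exact: measurableT_comp.
  have abs0 : {in setT, forall y, 0 <= (abse \o (EFin \o f)) y}%E.
    by move=> y _; rewrite /= lee_fin.
  have := ge0_integral_pushforward mphi m1 measurableT mabs abs0.
  rewrite /= => <-; rewrite (eq_measure_integral (pushforward m2 psi)); last first.
    by move=> A mA _; exact: m12.
  have -> := ge0_integral_pushforward mpsi m2 measurableT mabs abs0.
  by move/integrableP : intf => [].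
split => //.
rewrite -(@integral_pushforward _ _ _ _ _ _ mphi m1 setT (EFin \o f))//.
rewrite (eq_measure_integral (pushforward m2 psi)); last first.
  by move=> A mA _; exact: m12.
by rewrite integral_pushforward.
Qed.

(** Rectangles suffice to compare joint laws, and they are the form in which (conditional)
    independence of a pair is available. *)
Lemma has_mean_transfer2 d1 d2 d d' (T1 : measurableType d1)
    (T2 : measurableType d2) (E : measurableType d) (E' : measurableType d')
    (m1 : probability T1 R) (m2 : probability T2 R)
    (U : T1 -> E) (V : T1 -> E') (U' : T2 -> E) (V' : T2 -> E')
    (f : E * E' -> R) e :
  measurable_fun setT U -> measurable_fun setT V ->
  measurable_fun setT U' -> measurable_fun setT V' -> measurable_fun setT f ->
  (forall A B, measurable A -> measurable B ->
     m1 (U @^-1` A `&` V @^-1` B) = m2 (U' @^-1` A `&` V' @^-1` B)) ->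
  has_mean m2 (fun x => f (U' x, V' x)) e ->
  has_mean m1 (fun x => f (U x, V x)) e.
Proof.
move=> mU mV mU' mV' mf m12.
have mUV : measurable_fun setT (fun x => (U x, V x)) by exact: measurable_fun_pair.
have mUV' : measurable_fun setT (fun x => (U' x, V' x)) by exact: measurable_fun_pair.
apply: has_mean_transfer => //.
pose UV : {mfun T1 >-> (E * E')%type} :=
  HB.pack (fun x => (U x, V x)) (isMeasurableFun.Build _ _ _ _ _ mUV).
pose UV' : {mfun T2 >-> (E * E')%type} :=
  HB.pack (fun x => (U' x, V' x)) (isMeasurableFun.Build _ _ _ _ _ mUV').
apply: (@eq_measure_rect _ _ _ _ (distribution m1 UV) (distribution m2 UV')).
exact: m12.
Qed.

(** Independence says that [(U, V)] under [P] has the law of [(U \o fst, V \o snd)] under [P \x P],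
    where the mean of the product factors. *)
Lemma has_mean_indep d (T : measurableType d) (P : probability T R)
    (U V : T -> R) a b :
  (forall A B, measurable A -> measurable B ->
     P (U @^-1` A `&` V @^-1` B) = P (U @^-1` A) * P (V @^-1` B))%E ->
  has_mean P U a -> has_mean P V b -> has_mean P (fun x => U x * V x) (a * b).
Proof.
move=> UV Ua Vb; have mU := has_mean_measurable Ua.
have mV := has_mean_measurable Vb.
apply: (@has_mean_transfer2 _ _ _ _ _ _ _ _ P (P \x P)%E U V
  (U \o fst) (V \o snd) (fun z => z.1 * z.2)) => //.
- exact: measurableT_comp.
- exact: measurableT_comp.
- exact: measurable_funM.
- move=> A B mA mB; rewrite UV// -product_measure1E//.
  + by rewrite -[U @^-1` A]setTI; exact: mU.
  + by rewrite -[V @^-1` B]setTI; exact: mV.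
- exact: has_mean_prod.
Qed.

End has_mean_theory.

(** * Reflection and second moment of the normal density *)

Section normal_moments.
Context {R : realType}.
Local Notation mu := (@lebesgue_measure R).

Lemma measurable_reflect (m : R) :
  measurable_fun [set: measurableTypeR R] (fun x : R => m - x : measurableTypeR R).
Proof. exact: (@measurable_funB _ R R setT (cst m) id). Qed.

(** The reflection pulls []a, b]] back to [[m - b, m - a[], of the same length, and lengths of
    intervals determine Lebesgue measure. *)
Lemma lebesgue_measure_reflect (m : R) (A : set (measurableTypeR R)) :
  measurable A -> mu ((fun x => m - x) @^-1` A) = mu A.
Proof.
move=> mA; apply/esym.
pose phi : {mfun measurableTypeR R >-> measurableTypeR R} :=
  HB.pack (fun x : R => m - x : measurableTypeR R)
    (isMeasurableFun.Build _ _ _ _ _ (measurable_reflect m)).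
apply: (@lebesgue_measure_unique R (pushforward mu phi)) => //.
move=> _ [[a b] _ <-] /=; rewrite /pushforward /=.
rewrite (_ : _ @^-1` _ = `[m - b, m - a[%classic); last first.
  apply/seteqP; split => x /=; rewrite !in_itv/= => /andP[h1 h2];
    apply/andP; split; lra.
rewrite !lebesgue_measure_itv/= !lte_fin ltrD2l ltrN2.
case: ifP => // _; rewrite -!EFinB; congr EFin; ring.
Qed.

(* A single reflection gives both translation and symmetry of the normal law. *)
Lemma normal_prob_reflect (m s : R) (A : set (measurableTypeR R)) :
  s != 0 -> measurable A ->
  normal_prob m s A = normal_prob 0 s ((fun x => m - x) @^-1` A).
Proof.
move=> s0 mA.
have mpdf : measurable_fun setT (EFin \o normal_pdf m s).
  by apply/measurable_EFinP; exact: measurable_normal_pdf.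
rewrite /normal_prob.
pose phi : {mfun measurableTypeR R >-> measurableTypeR R} :=
  HB.pack (fun x : R => m - x : measurableTypeR R)
    (isMeasurableFun.Build _ _ _ _ _ (measurable_reflect m)).
(* Lebesgue measure equals its image under the reflection; changing variables then turns [x - m]
   into [- x] inside a square. *)
transitivity (\int[pushforward mu phi]_(x in A) (normal_pdf m s x)%:E)%E.
  apply: eq_measure_integral => B mB _.
  exact/esym/(lebesgue_measure_reflect m mB).
have mA' : measurable_fun A (EFin \o normal_pdf m s) by exact: measurable_funTS.
have pdf0 : {in A, forall y, 0 <= (EFin \o normal_pdf m s) y}%E.
  by move=> y _; rewrite lee_fin normal_pdf_ge0.
have -> := ge0_integral_pushforward (measurable_reflect m) mu mA mA' pdf0.
apply: eq_integral => x _; rewrite /= !normal_pdfE// /normal_fun.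
by rewrite (_ : m - x - m = - x) ?subr0 ?sqrrN//; ring.
Qed.


(** The Radon-Nikodym derivative of the normal law equals its density almost everywhere, both having
    the same integral over every measurable set. *)
Lemma ge0_integral_normal_prob (m s : R) (f : measurableTypeR R -> \bar R) :
  measurable_fun setT f -> (forall x, 0 <= f x)%E ->
  (\int[normal_prob m s]_x f x = \int[mu]_x (f x * (normal_pdf m s x)%:E))%E.
Proof.
move=> mf f0; have Nmu := @normal_prob_dominates R m s.
rewrite -(Radon_Nikodym_SigmaFinite.change_of_variables Nmu f0)//.
have mRN := measurable_int _ (Radon_Nikodym_SigmaFinite.f_integrable Nmu).
have mpdf : measurable_fun setT (fun x => (normal_pdf m s x)%:E).
  by apply/measurable_EFinP; exact: measurable_normal_pdf.
apply: ae_eq_integral => //; [exact: emeasurable_funM..|].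
apply: ae_eqe_mul2l; apply: integral_ae_eq => //.
  exact: Radon_Nikodym_SigmaFinite.f_integrable.
by move=> E _ mE; rewrite -Radon_Nikodym_SigmaFinite.f_integral.
Qed.

Lemma is_derive_normal_pdf (s x : R) : s != 0 ->
  is_derive x 1 (fun t : R => - (s ^+ 2 * normal_pdf 0 s t))
    (x * normal_pdf 0 s x).
Proof.
move=> s0; rewrite normal_pdfE// /normal_fun.
apply: is_derive_eq => //=.
by rewrite /GRing.scale /= !subr0; set e := expR _; field.
Qed.

Lemma cvg_normal_pdf (s : R) : 0 < s -> normal_pdf 0 s x @[x --> +oo] --> (0 : R).
Proof.
move=> s0; rewrite normal_pdfE ?gt_eqF//.
rewrite -[X in _ --> X](mulr0 (normal_peak s)); apply: cvgMr.
have s20 : 0 < Num.sqrt (s ^+ 2 *+ 2) by rewrite sqrtr_gt0 pmulrn_lgt0// exprn_gt0.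
(* Rescaling by the square root of [2 s^2] reduces to the standard bell curve. *)
have -> : normal_fun 0 s = fun x => gauss_fun (x / Num.sqrt (s ^+ 2 *+ 2)).
  apply/funext => x; rewrite /normal_fun /gauss_fun subr0 exprMn exprVn.
  by rewrite sqr_sqrtr ?mulNr// pmulrn_lge0// sqr_ge0.
apply: cvg_comp; last exact: cvg_gauss_fun.
by apply: gt0_cvgMly; [rewrite invr_gt0|exact: cvg_id].
Qed.

(** Fundamental theorem of calculus on a half-line, with antiderivative [- s^2 g], which vanishes at
    infinity. *)
Lemma integral_tail_normal_pdf (s x : R) : 0 < s -> 0 <= x ->
  (\int[mu]_(t in `[x, +oo[) (t * normal_pdf 0 s t)%:E
   = (s ^+ 2 * normal_pdf 0 s x)%:E)%E.
Proof.
move=> s0 x0; have sn0 : s != 0 by rewrite gt_eqF.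
pose F t : R := - (s ^+ 2 * normal_pdf 0 s t).
have dF t := @is_derive_normal_pdf s t sn0.
have cf : continuous (fun t : R => t * normal_pdf 0 s t).
  by move=> t; apply: cvgM; [exact: cvg_id|exact: continuous_normal_pdf].
have cF : continuous F.
  move=> t; apply: cvgN; apply: cvgMr; exact: continuous_normal_pdf.
rewrite (@ge0_continuous_FTC2y R _ F x 0).
- by rewrite /F -EFinB sub0r opprK.
- by move=> t xt; rewrite mulr_ge0 ?normal_pdf_ge0// (le_trans x0).
- exact: continuous_subspaceT.
- rewrite -oppr0 -(mulr0 (s ^+ 2)).
  by apply: cvgN; apply: cvgMr; exact: cvg_normal_pdf.
- by move=> t _; have [] := dF t.
- by apply: cvg_at_right_filter; exact: cF.
- by move=> t _; rewrite derive1E; have [] := dF t.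
Qed.


(* Tonelli for [1_(0 <= x <= t) t g(t)], [g] the density: integrating first in
   [t] gives [s^2 g(x)] on the half-line, integrating first in [x] gives
   [t^2 g(t)]. *)
Lemma half_second_moment (s : R) : 0 < s ->
  (\int[mu]_(t in [set t | (0 <= t)%R]) (t ^+ 2 * normal_pdf 0 s t)%:E =
   \int[mu]_(x in [set x | (0 <= x)%R]) (s ^+ 2 * normal_pdf 0 s x)%:E)%E.
Proof.
move=> s0.
pose k (z : measurableTypeR R * measurableTypeR R) : R :=
  if (0 <= z.1 :> R) && (z.1 <= z.2 :> R) then z.2 * normal_pdf 0 s z.2 else 0.
have m1 : measurable_fun [set: measurableTypeR R * measurableTypeR R]
    (fun z => z.1 : R) by exact: measurable_fst.
have m2 : measurable_fun [set: measurableTypeR R * measurableTypeR R]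
    (fun z => z.2 : R) by exact: measurable_snd.
have mk : measurable_fun setT (EFin \o k).
  apply/measurable_EFinP/measurable_fun_ifT => //.
  - apply: measurable_and; apply: measurable_fun_ler => //.
  - apply: measurable_funM => //.
    exact: measurableT_comp (measurable_normal_pdf 0 s) m2.
have k0 z : (0 <= (EFin \o k) z)%E.
  rewrite /= lee_fin /k; case: ifPn => // /andP[z0 z12].
  by rewrite mulr_ge0 ?normal_pdf_ge0// (le_trans z0).
have kE := fubini_tonelli (m1 := mu) (m2 := mu) _ mk k0.
rewrite [LHS]integral_mkcond [RHS]integral_mkcond.
transitivity (\int[mu]_t \int[mu]_x (EFin \o k) (x, t))%E; last first.
  rewrite -kE; apply: eq_integral => x _; rewrite patchE /k /=.
  case: ifPn; rewrite ?inE /= ?notin_setE /= => x0.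
    rewrite -(integral_tail_normal_pdf s0 x0).
    rewrite [RHS]integral_mkcond.
    apply: eq_integral => t _; rewrite patchE x0 /=.
    by rewrite mem_setE in_itv/= andbT; case: ifP.
  apply: integral0_eq => t _.
  by case: ifP => [/andP[h _]|_]; [case: (x0 h)|].
apply: eq_integral => t _; rewrite patchE /k /=.
case: ifPn; rewrite ?inE /= ?notin_setE /= => t0; last first.
  apply/esym; apply: integral0_eq => x _.
  by case: ifP => [/andP[x0 xt]|_]; [case: t0; exact: le_trans xt|].
transitivity (\int[mu]_(x in `[0%R, t]) (t * normal_pdf 0 s t)%:E)%E.
  have -> : (\int[mu]_(x in `[0%R, t]) (t * normal_pdf 0 s t)%:E =
      (t * normal_pdf 0 s t)%:E * mu `[0%R, t]%classic)%E.
    by apply: integral_cst; exact: measurable_itv.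
  rewrite lebesgue_measure_itv/= lte_fin oppr0 adde0.
  have [_|t0'] := ltrP 0 t; first by rewrite -EFinM; congr EFin; ring.
  (* Here [t = 0]: the interval is a point and both sides vanish. *)
  by rewrite (le_anti (introT andP (conj t0' t0))) mule0 expr0n mul0r.
rewrite [LHS]integral_mkcond; apply: eq_integral => x _; rewrite patchE.
by rewrite mem_setE in_itv/=; case: ifP.
Qed.

(** Evenness is used twice: to pass to the half-line, where the Tonelli identity applies, and to
    come back to the full line, where the density has mass 1. *)
Lemma integral_sqr_normal_pdf (s : R) : 0 < s ->
  (\int[mu]_x (x ^+ 2 * normal_pdf 0 s x)%:E = (s ^+ 2)%:E)%E.
Proof.
move=> s0; have sn0 : s != 0 by rewrite gt_eqF.
have evenN x : normal_pdf 0 s (- x) = normal_pdf 0 s x.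
  by rewrite !normal_pdfE// /normal_fun !subr0 sqrrN.
rewrite ge0_symfun_integralT; last 3 first.
- by move=> x; rewrite mulr_ge0 ?sqr_ge0 ?normal_pdf_ge0.
- move=> x; apply: cvgM; [exact: sqr_continuous|exact: continuous_normal_pdf].
- by move=> x /=; rewrite evenN sqrrN.
rewrite half_second_moment// -ge0_symfun_integralT; last 3 first.
- by move=> x; rewrite mulr_ge0 ?sqr_ge0 ?normal_pdf_ge0.
- move=> x; apply: cvgMr; exact: continuous_normal_pdf.
- by move=> x /=; rewrite evenN.
under eq_integral do rewrite EFinM.
rewrite integralZl//; last exact: integrable_normal_pdf.
by rewrite integral_normal_pdf mule1.
Qed.

Lemma integral_sqr_normal_prob (s : R) : 0 < s ->
  (\int[normal_prob 0 s]_x (x ^+ 2)%:E = (s ^+ 2)%:E)%E.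
Proof.
move=> s0; rewrite ge0_integral_normal_prob.
- by under eq_integral do rewrite -EFinM; exact: integral_sqr_normal_pdf.
- by apply/measurable_EFinP; exact: (@measurable_funX _ _ R setT id).
- by move=> x; rewrite lee_fin sqr_ge0.
Qed.

End normal_moments.

(** * Means under normal laws and mixtures of normal laws *)

Section normal_means.
Context {R : realType}.

Lemma has_mean_normal_sqr (s : R) : 0 < s ->
  has_mean (normal_prob 0 s) (fun x => x ^+ 2) (s ^+ 2).
Proof.
move=> s0; split; last exact: integral_sqr_normal_prob.
apply/integrableP; split.
  by apply/measurable_EFinP; exact: (@measurable_funX _ _ R setT id).
under eq_integral do rewrite /= ger0_norm ?sqr_ge0//.
by rewrite integral_sqr_normal_prob// ltry.
Qed.

(** [|x| <= 1 + x^2] gives integrability from the second moment; symmetry of the law then makes the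
    mean equal to its opposite. *)
Lemma has_mean_normal_id (s : R) : 0 < s -> has_mean (normal_prob 0 s) id 0.
Proof.
move=> s0; have mid : measurable_fun [set: measurableTypeR R] (id : R -> R).
  exact: measurable_id.
have xi : (normal_prob 0 s).-integrable setT (EFin \o (id : R -> R)).
  have [h _] := has_meanD (has_mean_cst (normal_prob 0 s) 1) (has_mean_normal_sqr s0).
  apply: le_integrable h => //; first exact/measurable_EFinP.
  move=> x _; rewrite /= lee_fin [leRHS]ger0_norm ?addr_ge0 ?sqr_ge0//.
  rewrite -(real_normK (num_real x)); have := sqr_ge0 (`|x| - 1).
  have := normr_ge0 x; nra.
have [e xe] : exists e, has_mean (normal_prob 0 s) id e.
  exists (fine (\int[normal_prob 0 s]_x x%:E)%E).
  by split => //; rewrite fineK// integrable_fin_num.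
suff [_ xNe] : has_mean (normal_prob 0 s) id (- e).
  have [_] := xe; rewrite xNe => -[ee].
  have e0 : e = 0 by lra.
  by move: xe; rewrite e0.
apply: (@has_mean_transfer _ _ _ _ _ _ _ (normal_prob 0 s) (normal_prob 0 s)
  id (fun x : R => 0 - x : measurableTypeR R) id) => //.
- exact: measurable_reflect.
- by move=> A mA; apply: normal_prob_reflect => //; rewrite gt_eqF.
- by under [X in has_mean _ X]funext do rewrite sub0r; exact: has_meanN.
Qed.

(** In law [U] is [m - x] with [x] centered normal, so [U - m] is [- x]. *)
Lemma has_mean_normal_law d (T : measurableType d) (P : probability T R)
    (U : T -> R) (m s : R) : 0 < s -> measurable_fun setT U ->
  (forall A, measurable A -> P (U @^-1` A) = normal_prob m s A) ->
  has_mean P (fun w => U w - m) 0 /\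
  has_mean P (fun w => (U w - m) ^+ 2) (s ^+ 2).
Proof.
move=> s0 mU UA; split.
- apply: (@has_mean_transfer _ _ _ _ _ _ _ P (normal_prob 0 s) U
    (fun x : R => m - x : R) (fun x => x - m)) => //.
  + exact: measurable_reflect.
  + exact: measurable_funB.
  + by move=> A mA; rewrite (UA A mA) (normal_prob_reflect m (lt0r_neq0 s0) mA).
  + under [X in has_mean _ X]funext do rewrite addrAC subrr sub0r.
    by have := has_meanN (has_mean_normal_id s0); rewrite oppr0.
- apply: (@has_mean_transfer _ _ _ _ _ _ _ P (normal_prob 0 s) U
    (fun x : R => m - x : R) (fun x => (x - m) ^+ 2)) => //.
  + exact: measurable_reflect.
  + by apply: measurable_funX; exact: measurable_funB.
  + by move=> A mA; rewrite (UA A mA) (normal_prob_reflect m (lt0r_neq0 s0) mA).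
  + under [X in has_mean _ X]funext do rewrite addrAC subrr sub0r sqrrN.
    exact: has_mean_normal_sqr.
Qed.

Section mixture.
Context d (T : measurableType d) (P : probability T R) (s m : R).
Hypothesis s0 : 0 < s.
Let N : probability (measurableTypeR R) R := normal_prob 0 s.

Lemma has_mean_centered_measurable (a : T -> R) (e : R) :
  has_mean P (fun w => a w - m) e -> measurable_fun setT a.
Proof.
move=> ae; have := measurable_funD (has_mean_measurable ae) (measurable_cst m).
by under [X in measurable_fun _ X -> _]funext do rewrite /= subrK.
Qed.

(* In law, [U] is [a w - x] with [x] an independent [N(0, s^2)] noise. *)
Lemma has_mean_normal_mixture (a U : T -> R) (e : R) :
  measurable_fun setT U ->
  (forall A, measurable A ->
    P (U @^-1` A) = \int[P]_w normal_prob (a w) s A)%E ->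
  has_mean P (fun w => a w - m) e -> has_mean P (fun w => U w - m) e.
Proof.
move=> mU UA ae.
have ma := has_mean_centered_measurable ae.
apply: (@has_mean_transfer _ _ _ _ _ _ _ P (P \x N)%E U
  (fun z : T * measurableTypeR R => a z.1 - (z.2 : R)) (fun x => x - m)).
- exact: mU.
- by apply: measurable_funB; [exact: measurableT_comp|exact: measurable_snd].
- exact: measurable_funB.
- move=> A mA; rewrite (UA A mA).
  (* The product measure integrates the measures of sections; the section at [w] is the reflection
     of [A] about [a w]. *)
  apply: eq_integral => w _; rewrite (normal_prob_reflect _ (lt0r_neq0 s0) mA).
  by congr (normal_prob 0 s _); apply/seteqP; split => x; rewrite /xsection /= inE.
(* The integrand is [(a - m) * 1 - 1 * x], a combination of products of one-variable functions. *)
- have := has_meanD (has_mean_prod ae (has_mean_cst N 1))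
    (has_meanN (has_mean_prod (has_mean_cst P 1) (has_mean_normal_id s0))).
  rewrite mulr0 oppr0 addr0 mulr1.
  by congr (has_mean _ _ _); apply/funext => z /=; ring.
Qed.

(** In law the pair is [(a w - x, b w - y)] with independent centered noises. The means [ea] and
    [eb] make the cross terms integrable. *)
Lemma has_mean_normal_mixture2 (a b U V : T -> R) (ea eb e : R) :
  measurable_fun setT U -> measurable_fun setT V ->
  (forall A B, measurable A -> measurable B ->
    P (U @^-1` A `&` V @^-1` B) =
    \int[P]_w (normal_prob (a w) s A * normal_prob (b w) s B))%E ->
  has_mean P (fun w => a w - m) ea -> has_mean P (fun w => b w - m) eb ->
  has_mean P (fun w => (a w - m) * (b w - m)) e ->
  has_mean P (fun w => (U w - m) * (V w - m)) e.
Proof.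
move=> mU mV UV ae be abe.
have ma := has_mean_centered_measurable ae.
have mb := has_mean_centered_measurable be.
have m1 : measurable_fun setT
    (fun z : T * (measurableTypeR R * measurableTypeR R) => z.2.1 : R).
  exact: measurableT_comp measurable_fst measurable_snd.
have m2 : measurable_fun setT
    (fun z : T * (measurableTypeR R * measurableTypeR R) => z.2.2 : R).
  exact: measurableT_comp measurable_snd measurable_snd.
apply: (@has_mean_transfer2 _ _ _ _ _ _ _ _ _ P (P \x (N \x N))%E U V
  (fun z => a z.1 - (z.2.1 : R)) (fun z => b z.1 - (z.2.2 : R))
  (fun x => (x.1 - m) * (x.2 - m))).
- exact: mU.
- exact: mV.
- by apply: measurable_funB => //; exact: measurableT_comp.
- by apply: measurable_funB => //; exact: measurableT_comp.
- by apply: measurable_funM; exact: measurable_funB.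
- move=> A B mA mB; rewrite (UV A B mA mB).
  apply: eq_integral => w _.
  rewrite (normal_prob_reflect _ (lt0r_neq0 s0) mA).
  rewrite (normal_prob_reflect _ (lt0r_neq0 s0) mB).
  have mA' : measurable ((fun x : measurableTypeR R => a w - x) @^-1` A).
    by rewrite -[X in measurable X]setTI; exact: measurable_reflect.
  have mB' : measurable ((fun x : measurableTypeR R => b w - x) @^-1` B).
    by rewrite -[X in measurable X]setTI; exact: measurable_reflect.
  rewrite -(product_measure1E N N mA' mB').
  by congr ((N \x N)%E _); apply/seteqP; split => x; rewrite /xsection /= inE.
- have hx := has_mean_normal_id s0; have h1 := has_mean_cst N 1.
  (* The four terms of [(a - m - x) * (b - m - y)]; the three that contain a noise have mean 0. *)
  have := has_meanD (has_meanD
    (has_mean_prod abe (has_mean_prod h1 h1))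
    (has_meanN (has_mean_prod ae (has_mean_prod h1 hx))))
    (has_meanD (has_meanN (has_mean_prod be (has_mean_prod hx h1)))
     (has_mean_prod (has_mean_cst P 1) (has_mean_prod hx hx))).
  rewrite !(mulr0, mul0r, mulr1, oppr0, addr0).
  by congr (has_mean _ _ _); apply/funext => z /=; ring.
Qed.

End mixture.
End normal_means.

(** * Marginals of the model and expansion of the statistic *)

Section model_lemmas.
Context {R : realType} {d0} {Omega : measurableType d0}
  (P : probability Omega R).

Lemma measurable_coord_preimage n (c : 'I_n) (A : set R) :
  measurable A -> measurable [set v : 'rV[R]_n | A (v ord0 c)].
Proof. by move=> mA; rewrite -[X in measurable X]setTI; exact: measurable_coord. Qed.

Lemma measurable_coordB_preimage n (c : 'I_n) (r : R) (A : set R) :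
  measurable A -> measurable [set v : 'rV[R]_n | A (v ord0 c - r)].
Proof.
move=> mA; rewrite -[X in measurable X]setTI.
exact: (measurable_funB (measurable_coord c) (measurable_cst r)).
Qed.

Lemma has_mean_expectation (f : Omega -> R) (e : R) :
  has_mean P f e -> ('E_P[f] = e%:E)%E.
Proof. by rewrite unlock; case. Qed.

(** A one-coordinate event is a box whose other sides are the full line, of mass 1. *)
Lemma gaussian_coord n (m : 'rV[R]_n) s (c : 'I_n) (A : set R) :
  measurable A ->
  gaussian m s [set v | A (v ord0 c)] = normal_prob (m ord0 c) s A.
Proof.
move=> mA; pose A' c' := if c' == c then A else setT.
transitivity (gaussian m s [set v | forall c', A' c' (v ord0 c')]).
  congr (gaussian m s _); apply/seteqP; split => v /= h;
    last by have := h c; rewrite /A' eqxx.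
  by move=> c'; rewrite /A'; case: eqP => [->|].
rewrite gaussian_box; last by move=> c'; rewrite /A'; case: ifP.
rewrite (bigD1 c)//= /A' eqxx big1 ?mule1// => c' /negbTE ->.
exact: probability_setT.
Qed.

Section families.
Context (J : finType) d' (E : measurableType d') (Y : J -> Omega -> E).

Lemma mutually_independent2 (i j : J) (A B : set E) :
  mutually_independent P Y -> i != j -> measurable A -> measurable B ->
  (P (Y i @^-1` A `&` Y j @^-1` B) = P (Y i @^-1` A) * P (Y j @^-1` B))%E.
Proof.
move=> indep ij mA mB.
pose C l := if l == i then A else if l == j then B else setT.
have Ci : C i = A by rewrite /C eqxx.
have Cj : C j = B by rewrite /C eq_sym (negbTE ij) eqxx.
have mC l : measurable (C l) by rewrite /C; do 2 case: ifP => // _.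
rewrite (_ : _ `&` _ = \bigcap_l Y l @^-1` C l).
  rewrite indep// (bigD1 i)//= (bigD1 j)/=; last by rewrite eq_sym.
  rewrite Ci Cj big1 ?mule1// => l /andP[/negbTE li /negbTE lj].
  by rewrite /C li lj preimage_setT probability_setT.
apply/seteqP; split => w /=; last first.
  by move=> h; split; [rewrite -Ci|rewrite -Cj]; exact: h.
by move=> [hi hj] l _ /=; rewrite /C; case: eqP => [->//|_]; case: eqP => [->//|].
Qed.

Context (G : set (set Omega)) (K : J -> Omega -> probability E R).
Hypotheses (GT : G setT) (YK : conditionally_independent P G Y K).

(** Conditioning on the sure event, and giving every other index the sure event, leaves the mixture
    of products of two kernels. *)
Lemma conditionally_independent2 (i j : J) (A B : set E) :
  i != j -> measurable A -> measurable B ->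
  (P (Y i @^-1` A `&` Y j @^-1` B) = \int[P]_w (K i w A * K j w B))%E.
Proof.
move=> ij mA mB.
pose C l := if l == i then A else if l == j then B else setT.
have Ci : C i = A by rewrite /C eqxx.
have Cj : C j = B by rewrite /C eq_sym (negbTE ij) eqxx.
have mC l : measurable (C l) by rewrite /C; do 2 case: ifP => // _.
rewrite (_ : _ `&` _ = setT `&` \bigcap_l Y l @^-1` C l).
  rewrite YK//; apply: eq_integral => w _.
  rewrite (bigD1 i)//= (bigD1 j)/=; last by rewrite eq_sym.
  rewrite Ci Cj big1 ?mule1// => l /andP[/negbTE li /negbTE lj].
  by rewrite /C li lj probability_setT.
rewrite setTI; apply/seteqP; split => w /=; last first.
  by move=> h; split; [rewrite -Ci|rewrite -Cj]; exact: h.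
by move=> [hi hj] l _ /=; rewrite /C; case: eqP => [->//|_]; case: eqP => [->//|].
Qed.

Lemma conditionally_independent1 (i : J) (A : set E) : measurable A ->
  (P (Y i @^-1` A) = \int[P]_w K i w A)%E.
Proof.
move=> mA; pose C l := if l == i then A else setT.
have Ci : C i = A by rewrite /C eqxx.
have mC l : measurable (C l) by rewrite /C; case: ifP.
rewrite (_ : _ @^-1` _ = setT `&` \bigcap_l Y l @^-1` C l).
  rewrite YK//; apply: eq_integral => w _.
  rewrite (bigD1 i)//= Ci big1 ?mule1// => l /negbTE li.
  by rewrite /C li probability_setT.
rewrite setTI; apply/seteqP; split => w /=; last first.
  by move=> h; rewrite -Ci; exact: h.
by move=> hi l _ /=; rewrite /C; case: eqP => [->//|].
Qed.

End families.

Lemma sigma_generatedT (J : Type) d' (E : measurableType d')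
  (Y : J -> Omega -> E) : sigma_generated Y setT.
Proof. by rewrite -setC0; apply: sigma_algebraC; exact: sigma_algebra0. Qed.

Lemma sigma_generated_preimage (J : Type) d' (E : measurableType d')
    (Y : J -> Omega -> E) (j : J) (A : set E) :
  measurable A -> sigma_generated Y (Y j @^-1` A).
Proof.
move=> mA; apply: sub_sigma_algebra; exists j => //.
by exists A => //; rewrite setTI.
Qed.

Lemma measurable_RV_coord n (Y : {RV P >-> 'rV[R]_n}) (c : 'I_n) :
  measurable_fun setT (fun w => Y w ord0 c).
Proof. exact: measurableT_comp (measurable_coord c) (measurable_funPT Y). Qed.

(** Positivity of [n] matters: since [0^-1 = 0], an empty average is 0 and the left side would be
    [- m]. *)
Lemma mean_center n (m : R) (x : 'I_n -> R) : (0 < n)%N ->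
  n%:R^-1 * \sum_i x i - m = n%:R^-1 * \sum_i (x i - m).
Proof.
move=> n0; rewrite sumrB sumr_const card_ord mulrBr -[m *+ n]mulr_natl mulrA.
by rewrite mulVf ?mul1r// pnatr_eq0 -lt0n.
Qed.

Lemma muhat_center d T N (X : 'I_T -> 'I_N -> Omega -> 'rV[R]_d)
    (m : 'rV[R]_d) w c : (0 < T)%N -> (0 < N)%N ->
  muhat X w ord0 c - m ord0 c =
  T%:R^-1 * \sum_i (N%:R^-1 * \sum_j (X i j w ord0 c - m ord0 c)).
Proof.
move=> T0 N0; rewrite mxE summxE mean_center//; congr (_ * _).
by apply: eq_bigr => i _; rewrite mxE summxE mean_center.
Qed.

(** Only the challenge average is expanded: the OUT case uses independence from [muhat] as a whole.
    A common value [e] cancels the average over [l] and leaves one term per coordinate. *)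
Lemma has_mean_statistic d T N k (X : 'I_T -> 'I_N -> Omega -> 'rV[R]_d)
    (B : 'I_k -> Omega -> 'rV[R]_d) (m : 'rV[R]_d) (e : R) : (0 < k)%N ->
  (forall c l, has_mean P
     (fun w => (muhat X w ord0 c - m ord0 c) * (B l w ord0 c - m ord0 c)) e) ->
  has_mean P (statistic m X B) (d%:R * e).
Proof.
move=> k0 XB.
have -> : statistic m X B = fun w => \sum_c (k%:R^-1 * \sum_l
    ((muhat X w ord0 c - m ord0 c) * (B l w ord0 c - m ord0 c))).
  apply/funext => w; apply: eq_bigr => c _.
  have coordB (u : 'rV[R]_d) : (u - m) ord0 c = u ord0 c - m ord0 c.
    by rewrite mxE; congr (_ + _); rewrite mxE.
  rewrite !coordB -mulr_sumr mulrCA -mean_center//.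
  by congr (_ * (_ - _)); rewrite mxE summxE.
have -> : d%:R * e = \sum_(c < d) (k%:R^-1 * \sum_(l < k) e).
  rewrite !sumr_const !card_ord -[e *+ k]mulr_natl mulrA mulVf ?mul1r ?mulr_natl//.
  by rewrite pnatr_eq0 -lt0n.
by apply: has_mean_sum => c; apply: has_meanZ; apply: has_mean_sum => l.
Qed.

End model_lemmas.

(** * Expectations in the OUT and IN cases *)

Theorem theorem4p2 (R : realType) (d T N k : nat)
    (d_ge1 : (1 <= d)%N) (T_ge1 : (1 <= T)%N) (N_ge1 : (1 <= N)%N)
    (k_ge1 : (1 <= k)%N) (k_leN : (k <= N)%N)
    (mubar : 'rV[R]_d) (sigma sigmabar : R)
    (sigma_gt0 : 0 < sigma) (sigmabar_gt0 : 0 < sigmabar)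
    (disp : measure_display) (Omega : measurableType disp)
    (P : probability Omega R)
    (mu : 'I_T -> {RV P >-> 'rV[R]_d})
    (X : 'I_T -> 'I_N -> {RV P >-> 'rV[R]_d})
    (tau : 'I_T)
    (model : tasks_and_data P mubar sigma sigmabar mu X) :
  (forall (muout : {RV P >-> 'rV[R]_d}) (Bout : 'I_k -> {RV P >-> 'rV[R]_d}),
     out_challenge P mubar sigma sigmabar mu X muout Bout ->
     ('E_P[statistic mubar X Bout] = 0)%E) /\
  (forall Bin : 'I_k -> {RV P >-> 'rV[R]_d},
     weak_in_challenge P sigma mu X tau Bin ->
     ('E_P[statistic mubar X Bin] = (d%:R / T%:R * sigmabar ^+ 2)%R%:E)%E).
Proof.
have [[mu_indep mu_law] X_mu] := model.
have law_means (Y : {RV P >-> 'rV[R]_d}) c :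
    has_law P Y (gaussian mubar sigmabar) ->
    has_mean P (fun w => Y w ord0 c - mubar ord0 c) 0 /\
    has_mean P (fun w => (Y w ord0 c - mubar ord0 c) ^+ 2) (sigmabar ^+ 2).
  move=> Y_law; apply: has_mean_normal_law sigmabar_gt0 _ _.
    exact: measurable_RV_coord.
  move=> A mA; rewrite -(gaussian_coord _ _ c mA).
  exact: (Y_law _ (measurable_coord_preimage c mA)).
have mean_mu i c := (law_means (mu i) c (mu_law i)).1.
have muT : sigma_generated mu setT by exact: sigma_generatedT.
split.
  (* OUT case: for each coordinate and sample, two independent centered factors. *)
  move=> muout B [muout_law _ B_muout B_muhat].
  have muoutT : sigma_generated (fun _ : unit => muout) setT.
    exact: sigma_generatedT.
  transitivity ((d%:R * 0 : R)%:E); last by rewrite mulr0.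
  apply: has_mean_expectation; apply: has_mean_statistic => // c l.
  rewrite -[X in has_mean _ _ X](mulr0 0); apply: has_mean_indep.
  - move=> A A' mA mA'; rewrite setIC muleC.
    apply: B_muhat.
      exact: (sigma_generated_preimage (Y := B) l
        (measurable_coordB_preimage c (mubar ord0 c) mA')).
    exact: (sigma_generated_preimage (Y := fun _ : unit => muhat X) tt
        (measurable_coordB_preimage c (mubar ord0 c) mA)).
  (* [muhat] is an average of data points, each a normal mixture around its task mean, which is
     itself centered at [mubar]. *)
  - under [X in has_mean _ X]funext do rewrite muhat_center//.
    rewrite [X in has_mean _ _ X](_ : 0 =
        T%:R^-1 * \sum_(i < T) (N%:R^-1 * \sum_(j < N) 0)); last first.
      by rewrite big1 ?mulr0// => i _; rewrite big1 ?mulr0.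
    apply: has_meanZ; apply: has_mean_sum => i.
    apply: has_meanZ; apply: has_mean_sum => j.
    apply: (has_mean_normal_mixture sigma_gt0 (a := fun w => mu i w ord0 c)).
    + exact: measurable_RV_coord.
    + move=> A mA; have mA' := measurable_coord_preimage c mA.
      have := conditionally_independent1 muT X_mu (i, j) mA'.
      by rewrite /preimage/= => ->; apply: eq_integral => w _; rewrite gaussian_coord.
    + exact: mean_mu.
  - apply: (has_mean_normal_mixture sigma_gt0 (a := fun w => muout w ord0 c)).
    + exact: measurable_RV_coord.
    + move=> A mA; have mA' := measurable_coord_preimage c mA.
      have := conditionally_independent1 muoutT B_muout l mA'.
      by rewrite /preimage/= => ->; apply: eq_integral => w _; rewrite gaussian_coord.
    + exact: (law_means muout c muout_law).1.
move=> B XB_mu; rewrite -mulrA; apply: has_mean_expectation.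
apply: has_mean_statistic => // c l.
(* IN case: the target is spread over all pairs [(i, j)]; only the [N] pairs with [i = tau]
   contribute, which yields the factor [1/T]. *)
have -> : T%:R^-1 * sigmabar ^+ 2 = T%:R^-1 * \sum_(i < T) (N%:R^-1 *
    \sum_(j < N) (if i == tau then sigmabar ^+ 2 else 0)).
  congr (_ * _); rewrite (bigD1 tau)//= eqxx [X in _ + X]big1 ?addr0.
    rewrite /= sumr_const card_ord -[_ ^+ 2 *+ N]mulr_natl mulrA mulVf ?mul1r//.
    by rewrite pnatr_eq0 -lt0n.
  by move=> i /negbTE ->; rewrite big1 ?mulr0.
have -> : (fun w => (muhat X w ord0 c - mubar ord0 c) *
      (B l w ord0 c - mubar ord0 c)) =
    (fun w => T%:R^-1 * \sum_i (N%:R^-1 * \sum_j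
      ((X i j w ord0 c - mubar ord0 c) * (B l w ord0 c - mubar ord0 c)))).
  apply/funext => w; rewrite muhat_center// -mulrA mulr_suml; congr (_ * _).
  by apply: eq_bigr => i _; rewrite -mulrA mulr_suml.
apply: has_meanZ; apply: has_mean_sum => i.
apply: has_meanZ; apply: has_mean_sum => j.
apply: (has_mean_normal_mixture2 sigma_gt0 (a := fun w => mu i w ord0 c)
  (b := fun w => mu tau w ord0 c)).
- exact: measurable_RV_coord.
- exact: measurable_RV_coord.
- move=> A A' mA mA'.
  have mAc := measurable_coord_preimage c mA.
  have mAc' := measurable_coord_preimage c mA'.
  (* A data point and a challenge sample have distinct indices in the joint family even when
     [i = tau], so their noises are independent given the task means. *)
  have := conditionally_independent2 muT XB_mu
    (isT : inl (i, j) != inr l) mAc mAc'.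
  by rewrite /preimage/= => ->; apply: eq_integral => w _; rewrite !gaussian_coord.
- exact: mean_mu.
- exact: mean_mu.
(* What remains is the covariance of two task means in coordinate [c]: the variance for equal
   indices, 0 by independence otherwise. *)
case: eqP => [->|/eqP itau].
  exact: (law_means (mu tau) c (mu_law tau)).2.
rewrite -[X in has_mean _ _ X](mulr0 0); apply: has_mean_indep; last 2 first.
- exact: mean_mu.
- exact: mean_mu.
move=> A A' mA mA'; exact: (mutually_independent2 mu_indep itau
  (measurable_coordB_preimage c (mubar ord0 c) mA)
  (measurable_coordB_preimage c (mubar ord0 c) mA')).
Qed.
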